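(* For $n\geq 1$ and $f\in\mathcal{R}_{loc,b}([0,\infty))$ let $$S_{n}(f)(x)=(n+1)e^{-nx}\sum_{k=0}^{\infty}\frac{(nx)^{k}}{k!}\int_{k/n}^{(k+1)/n}f(t)\,\mathrm{d}t,\qquad x\in[0,\infty).$$ If $f\in\mathcal{R}_{loc,b}([0,\infty))$, then $S_{n}(f)(x)\rightarrow f(x)$ as $n\to\infty$ at each point $x$ of continuity of $f$ (and thus it converges almost everywhere on $[0,+\infty)$).
   Context: $\mathcal{R}_{loc,b}([0,\infty))$ is the space of all real-valued functions that are bounded on $[0,+\infty)$ and Riemann integrable on each compact subinterval. ''Almost everywhere'' refers to Lebesgue measure. The operators $S_n$ are the Szász-Mirakjan-Kantorovich operators; the convention $0^0=1$ is used. *)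

(* Defs.v *)
(* Functions, Riemann integrals and series live on the Stdlib reals with
   Coquelicot; the Lebesgue measure is the one of MathComp-Analysis on the same
   type [R], which [Rstruct] equips with a [realType] structure. *)
From Stdlib Require Import Reals Factorial Lra Lia.
From Coquelicot Require Import Coquelicot.

Open Scope R_scope.

(* A function on [0, +oo) is represented by [f : R -> R]; everything below only
   depends on the values of [f] on the nonnegative reals. *)
Definition Rlocb (f : R -> R) : Prop :=
  (exists M : R, forall t : R, 0 <= t -> Rabs (f t) <= M) /\
  (forall a b : R, 0 <= a -> a <= b -> ex_RInt f a b).

(* Relative to [0, +oo), so one-sided at 0. *)
Definition continuous_at_halfline (f : R -> R) (x : R) : Prop :=
  filterlim f (within (fun y : R => 0 <= y) (locally x)) (locally (f x)).

Definition SMK_term (n : nat) (f : R -> R) (x : R) (k : nat) : R :=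
  (INR n * x) ^ k / INR (fact k) * RInt f (INR k / INR n) (INR (k + 1) / INR n).

(* Only meaningful for [1 <= n]; note that [0 ^ 0 = 1] for [pow]. *)
Definition SMK (n : nat) (f : R -> R) (x : R) : R :=
  (INR n + 1) * exp (- (INR n * x)) * Series (SMK_term n f x).

(* [Series] is a total operator; its value in [SMK] is a genuine sum. *)
Lemma ex_series_SMK_term (n : nat) (f : R -> R) (x : R) :
  (1 <= n)%nat -> Rlocb f -> 0 <= x -> ex_series (SMK_term n f x).
Proof.
intros Hn [[M HM] Hint] Hx.
assert (Hn0 : 0 < INR n) by (apply lt_0_INR; lia).
set (y := INR n * x).
assert (Hy : 0 <= y) by (apply Rmult_le_pos; lra).
apply @ex_series_le with
  (b := fun k => (M * / INR n) * (y ^ k * / INR (fact k))).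
- intros k.
  assert (Hk : 0 <= INR k) by apply pos_INR.
  assert (Hfk : 0 < INR (fact k)) by apply INR_fact_lt_0.
  assert (Hinv : 0 < / INR n) by now apply Rinv_0_lt_compat.
  assert (Ha : 0 <= INR k / INR n) by (apply Rmult_le_pos; lra).
  assert (Hab : INR k / INR n <= INR (k + 1) / INR n).
  { apply Rmult_le_compat_r; [lra|]. apply le_INR; lia. }
  assert (HI : Rabs (RInt f (INR k / INR n) (INR (k + 1) / INR n))
               <= M * / INR n).
  { replace (M * / INR n)
      with ((INR (k + 1) / INR n - INR k / INR n) * M).
    - apply abs_RInt_le_const; [exact Hab | now apply Hint |].
      intros t Ht. apply HM. lra.
    - rewrite plus_INR. simpl (INR 1). field. lra. }
  change (Rabs (SMK_term n f x k)
          <= (M * / INR n) * (y ^ k * / INR (fact k))).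
  unfold SMK_term. fold y.
  assert (Hp : 0 <= y ^ k / INR (fact k)).
  { apply Rmult_le_pos; [now apply pow_le |].
    left. now apply Rinv_0_lt_compat. }
  rewrite Rabs_mult, (Rabs_pos_eq _ Hp), Rmult_comm.
  apply Rmult_le_compat_r; assumption.
- apply (ex_series_scal (V := R_NormedModule)).
  exists (exp y).
  apply is_series_ext with
    (a := fun k => scal (pow_n y k) (/ INR (fact k))).
  + intros k. rewrite pow_n_pow. reflexivity.
  + exact (is_exp_Reals y).
Qed.

(* Main.v *)
Require Import Defs.
From mathcomp Require Import all_boot all_order all_algebra.
From mathcomp Require Import all_classical all_reals all_analysis.
From mathcomp Require Import Rstruct Rstruct_topology.
From Stdlib Require Import Reals.
From Coquelicot Require Import Coquelicot.
From Stdlib Require Import Lra Lia.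
Import Order.TTheory Num.Theory.
Open Scope R_scope.

(** Up to the factor [(n + 1) / n], [SMK n f x] averages the cell means
    [n * RInt f (k/n) ((k+1)/n)] against the Poisson law of parameter [n * x].
    This law has variance [n * x], so after division by [n] the cells that
    matter lie at distance [O(n^(-1/2))] from [x], and the average tends to
    [f x] as soon as [f] is continuous at [x].

    Quantitatively, a bounded [f] that is continuous at [x] satisfies, for
    every [e > 0], a bound [|f t - f x| <= e + K * (t - x)^2]: near [x] by
    continuity, far from [x] because the quadratic term is at least [2 * sup |f|]
    ([quadratic_modulus]). Averaging this bound only involves the variance of
    the Poisson law ([poisson_variance]) and leaves an error
    [e + O(1/n)] ([SMK_error]).

    For the almost everywhere statement it remains to see that a Riemann
    integrable function is continuous almost everywhere. Riemann integrability
    gives step functions [phi] and [psi] with [|f - phi| <= psi] and with the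
    integral of [psi] as small as desired. Inside a cell where [phi] and [psi]
    are both constant, [f] varies by at most twice the value of [psi]; so the
    points where [f] jumps by [e] are nodes of the two subdivisions or lie in
    cells where [psi >= e / 2]. By Markov's inequality those cells have small
    total length, so the points of jump at least [e] have outer measure zero
    ([outer_jumps]), and the discontinuities lie in a countable union of
    such sets ([ae_continuous_at_halfline]). *)

(** * Moments of the Poisson weights *)

Lemma is_series_exp (y : R) : is_series (fun k => y ^ k / INR (Factorial.fact k)) (exp y).
Proof.
apply is_series_ext with (a := fun k => scal (pow_n y k) (/ INR (Factorial.fact k))).
- intros k. rewrite pow_n_pow. reflexivity.
- exact (is_exp_Reals y).
Qed.

(** Turns the recursion of the Poisson weights into a recursion of their
    factorial moments: the moment series are, after an index shift, multiples
    of each other. *)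
Lemma is_series_shift_scal (a b : nat -> R) (c l : R) :
  a 0%nat = 0 -> (forall k, a (S k) = c * b k) ->
  is_series b l -> is_series a (c * l).
Proof.
intros Ha0 HaS Hb.
apply is_series_decr_1.
apply is_series_ext with (a := fun k => scal c (b k)).
- intros k. rewrite HaS. reflexivity.
- replace (plus _ _) with (scal c l).
  + exact (is_series_scal c b l Hb).
  + rewrite Ha0. unfold plus, opp, scal; simpl. unfold mult; simpl. ring.
Qed.

Lemma poisson_weight_succ (y : R) (k : nat) :
  INR (S k) * (y ^ S k / INR (Factorial.fact (S k))) = y * (y ^ k / INR (Factorial.fact k)).
Proof.
change (Factorial.fact (S k)) with (S k * Factorial.fact k)%coq_nat.
rewrite mult_INR. simpl pow.
field. split; [apply INR_fact_neq_0 | apply not_0_INR; lia].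
Qed.

Lemma poisson_first_moment (y : R) :
  is_series (fun k => INR k * (y ^ k / INR (Factorial.fact k))) (y * exp y).
Proof.
apply is_series_shift_scal with (b := fun k => y ^ k / INR (Factorial.fact k)).
- simpl. ring.
- intros k. apply poisson_weight_succ.
- apply is_series_exp.
Qed.

Lemma poisson_factorial_moment (y : R) :
  is_series (fun k => INR k * (INR k - 1) * (y ^ k / INR (Factorial.fact k)))
    (y * (y * exp y)).
Proof.
apply is_series_shift_scal with (b := fun k => INR k * (y ^ k / INR (Factorial.fact k))).
- simpl. ring.
- intros k.
  transitivity ((INR (S k) - 1) * (INR (S k) * (y ^ S k / INR (Factorial.fact (S k))))).
  + ring.
  + rewrite poisson_weight_succ S_INR. ring.
- apply poisson_first_moment.
Qed.

(** From [(k - y)^2 = k (k - 1) + (1 - 2 y) k + y^2]. The weights are not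
    normalized, whence the factor [exp y]. *)
Lemma poisson_variance (y : R) :
  is_series (fun k => (INR k - y) ^ 2 * (y ^ k / INR (Factorial.fact k))) (y * exp y).
Proof.
pose w k := y ^ k / INR (Factorial.fact k).
apply is_series_ext with (a := fun k =>
  plus (INR k * (INR k - 1) * w k)
    (plus (scal (1 - 2 * y) (INR k * w k)) (scal (y ^ 2) (w k)))).
- intros k. unfold plus, scal; simpl. unfold mult; simpl. unfold w. ring.
- replace (y * exp y) with
    (plus (y * (y * exp y))
       (plus (scal (1 - 2 * y) (y * exp y)) (scal (y ^ 2) (exp y)))).
  + apply @is_series_plus; [exact (poisson_factorial_moment y)|].
    apply @is_series_plus; apply @is_series_scal.
    * exact (poisson_first_moment y).
    * exact (is_series_exp y).
  + unfold plus, scal; simpl. unfold mult; simpl. ring.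
Qed.

(** * Convergence at a point of continuity *)

(** Every [t] in the [k]-th cell satisfies
    [(t - x)^2 <= 2 (k/n - x)^2 + 2 / n^2]; the right-hand side is written in
    terms of [k - n x] so that summation over [k] meets the Poisson variance. *)
Lemma cell_average_error (f : R -> R) (n k : nat) (x e K : R) :
  (1 <= n)%coq_nat -> 0 <= x -> Rlocb f -> 0 <= K ->
  (forall t, 0 <= t -> Rabs (f t - f x) <= e + K * (t - x) ^ 2) ->
  Rabs (RInt f (INR k / INR n) (INR (k + 1)%coq_nat / INR n) - f x / INR n)
    <= (e + 2 * K / INR n ^ 2 * ((INR k - INR n * x) ^ 2 + 1)) / INR n.
Proof.
intros Hn Hx [_ Hint] HK Hf.
assert (Hn0 : 0 < INR n) by (apply lt_0_INR; lia).
assert (Hinv : 0 < / INR n) by now apply Rinv_0_lt_compat.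
assert (Hk : 0 <= INR k) by apply pos_INR.
set (a := INR k / INR n).
assert (Hb : INR (k + 1)%coq_nat / INR n = a + / INR n).
{ unfold a. rewrite plus_INR. simpl (INR 1). field. lra. }
rewrite Hb.
assert (Ha : 0 <= a) by (apply Rmult_le_pos; lra).
assert (Hi : ex_RInt f a (a + / INR n)) by (apply Hint; lra).
assert (Hc : ex_RInt (fun _ : R => f x) a (a + / INR n)) by apply ex_RInt_const.
replace (RInt f a (a + / INR n) - f x / INR n)
  with (RInt (fun t => minus (f t) (f x)) a (a + / INR n)); last first.
{ rewrite (RInt_minus _ _ _ _ Hi Hc) RInt_const.
  unfold minus, plus, opp, scal; simpl. unfold mult; simpl. field. lra. }
replace ((e + 2 * K / INR n ^ 2 * ((INR k - INR n * x) ^ 2 + 1)) / INR n)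
  with ((a + / INR n - a) * (e + K * (2 * (a - x) ^ 2 + 2 * (/ INR n) ^ 2))); last first.
{ unfold a. field. lra. }
apply abs_RInt_le_const.
- lra.
- exact (ex_RInt_minus _ _ _ _ Hi Hc).
- intros t Ht.
  apply Rle_trans with (1 := Hf t ltac:(lra)).
  apply Rplus_le_compat_l, Rmult_le_compat_l; [exact HK|].
  assert ((t - a) ^ 2 <= (/ INR n) ^ 2) by (apply pow_incr; lra).
  (* The square that makes 2 u^2 + 2 v^2 - (u + v)^2 = (u - v)^2 nonnegative,
     for u = a - x and v = t - a. *)
  assert (0 <= (2 * a - t - x) ^ 2) by apply pow2_ge_0.
  nra.
Qed.

(** The comparison value is [(1 + 1/n) * f x], the image under the operator of
    the constant function [f x]: the factor [n + 1] in front of cells of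
    length [1/n] does not reproduce constants. *)
Lemma SMK_error (f : R -> R) (n : nat) (x e K : R) :
  (1 <= n)%coq_nat -> 0 <= x -> Rlocb f -> 0 <= K ->
  (forall t, 0 <= t -> Rabs (f t - f x) <= e + K * (t - x) ^ 2) ->
  Rabs (SMK n f x - (1 + / INR n) * f x)
    <= (1 + / INR n) * (e + 2 * K * (x * / INR n + / INR n * / INR n)).
Proof.
intros Hn Hx Hf HK Hbd.
assert (Hn0 : 0 < INR n) by (apply lt_0_INR; lia).
pose (y := INR n * x).
assert (Hy : 0 <= y) by (apply Rmult_le_pos; lra).
pose w k := y ^ k / INR (Factorial.fact k).
assert (Hw : forall k, 0 <= w k).
{ intros k. apply Rmult_le_pos; [now apply pow_le|].
  left. apply Rinv_0_lt_compat, INR_fact_lt_0. }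
pose (c := 2 * K / INR n ^ 2).
pose err k := SMK_term n f x k - f x / INR n * w k.
pose bnd k := (e + c) / INR n * w k + c / INR n * ((INR k - y) ^ 2 * w k).
assert (Herr : is_series err (Series (SMK_term n f x) - f x / INR n * exp y)).
{ apply (is_series_minus (SMK_term n f x) (fun k => scal (f x / INR n) (w k))).
  - apply Series_correct, ex_series_SMK_term; assumption.
  - apply @is_series_scal. exact (is_series_exp y). }
assert (Hbnd : is_series bnd ((e + c) / INR n * exp y + c / INR n * (y * exp y))).
{ apply @is_series_plus; apply @is_series_scal.
  - exact (is_series_exp y).
  - exact (poisson_variance y). }
assert (Hle : forall k, Rabs (err k) <= bnd k).
{ intros k.
  replace (err k) with
    (w k * (RInt f (INR k / INR n) (INR (k + 1)%coq_nat / INR n) - f x / INR n)).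
  - rewrite Rabs_mult (Rabs_pos_eq _ (Hw k)).
    apply Rle_trans with
      (w k * ((e + c * ((INR k - INR n * x) ^ 2 + 1)) / INR n)).
    + apply Rmult_le_compat_l; [apply Hw|].
      now apply cell_average_error.
    + right. unfold bnd, y. field. lra.
  - unfold err, SMK_term, w, y. ring. }
assert (Hsum : Rabs (Series (SMK_term n f x) - f x / INR n * exp y)
  <= (e + c) / INR n * exp y + c / INR n * (y * exp y)).
{ rewrite <- (is_series_unique _ _ Herr), <- (is_series_unique _ _ Hbnd).
  apply Rle_trans with (Series (fun k => Rabs (err k))).
  - apply Series_Rabs. apply @ex_series_le with (b := bnd).
    + intros k. unfold norm; simpl. unfold abs; simpl.
      rewrite Rabs_Rabsolu. apply Hle.
    + now eexists; eauto.
  - apply Series_le.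
    + intros k. split; [apply Rabs_pos|apply Hle].
    + now eexists; eauto. }
assert (Hexp : exp (- y) * exp y = 1).
{ rewrite <- exp_plus, Rplus_opp_l. apply exp_0. }
assert (Hfac : 0 <= (INR n + 1) * exp (- y)).
{ apply Rmult_le_pos; [lra|left; apply exp_pos]. }
replace (SMK n f x - (1 + / INR n) * f x) with
  ((INR n + 1) * exp (- y) * (Series (SMK_term n f x) - f x / INR n * exp y)).
- rewrite Rabs_mult (Rabs_pos_eq _ Hfac).
  apply Rle_trans with (1 := Rmult_le_compat_l _ _ _ Hfac Hsum).
  right.
  replace ((INR n + 1) * exp (- y)
    * ((e + c) / INR n * exp y + c / INR n * (y * exp y)))
    with ((INR n + 1) * (exp (- y) * exp y)
    * ((e + c) / INR n + c / INR n * y)) by ring.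
  rewrite Hexp. unfold c, y. field. lra.
- unfold SMK. fold y.
  replace ((INR n + 1) * exp (- y) * (Series (SMK_term n f x) - f x / INR n * exp y))
   with ((INR n + 1) * exp (- y) * Series (SMK_term n f x)
     - (INR n + 1) * (exp (- y) * exp y) * (f x / INR n)) by ring.
  rewrite Hexp. field. lra.
Qed.

Definition stays_within (f : R -> R) (e x : R) : Prop :=
  exists d, 0 < d /\
    forall t, 0 <= t -> Rabs (t - x) < d -> Rabs (f t - f x) < e.

Lemma continuous_at_halfline_spec (f : R -> R) (x : R) :
  continuous_at_halfline f x <->
  forall e, 0 < e -> stays_within f e x.
Proof.
split.
- intros Hc e He.
  destruct (proj1 (filterlim_locally _ _) Hc (mkposreal e He)) as [d Hd].
  exists d. split; [apply cond_pos|].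
  intros t Ht Htx. exact (Hd t Htx Ht).
- intros Hc. apply filterlim_locally. intros e.
  destruct (Hc e (cond_pos e)) as [d [Hd Hde]].
  exists (mkposreal d Hd). intros t Htx Ht. exact (Hde t Ht Htx).
Qed.

(** Within the distance [d] given by continuity, [e] alone suffices; beyond it,
    [K = 2 M / d^2] makes the quadratic term at least [2 M]. *)
Lemma quadratic_modulus (f : R -> R) (x e : R) :
  0 <= x -> Rlocb f -> continuous_at_halfline f x -> 0 < e ->
  exists K, 0 <= K /\
    forall t, 0 <= t -> Rabs (f t - f x) <= e + K * (t - x) ^ 2.
Proof.
intros Hx [[M HM] _] Hc He.
destruct (proj1 (continuous_at_halfline_spec f x) Hc e He) as [d [Hd Hde]].
assert (HM0 : 0 <= M) by (apply Rle_trans with (2 := HM x Hx), Rabs_pos).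
assert (Hd2 : 0 < d ^ 2) by now apply pow_lt.
exists (2 * M / d ^ 2). split.
{ apply Rmult_le_pos; [lra|]. left. now apply Rinv_0_lt_compat. }
intros t Ht.
destruct (Rlt_le_dec (Rabs (t - x)) d) as [Hlt|Hge].
- apply Rle_trans with e; [left; now apply Hde|].
  assert (0 <= 2 * M / d ^ 2 * (t - x) ^ 2); [|lra].
  apply Rmult_le_pos; [|apply pow2_ge_0].
  apply Rmult_le_pos; [lra|]. left. now apply Rinv_0_lt_compat.
- apply Rle_trans with (2 * M).
  + apply Rle_trans with (1 := Rabs_triang _ _). rewrite Rabs_Ropp.
    pose proof (HM t Ht). pose proof (HM x Hx). lra.
  + assert (Hsq : d ^ 2 <= (t - x) ^ 2).
    { rewrite <- (pow2_abs (t - x)). apply pow_incr; lra. }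
    assert (2 * M / d ^ 2 * d ^ 2 <= 2 * M / d ^ 2 * (t - x) ^ 2).
    { apply Rmult_le_compat_l; [|exact Hsq].
      apply Rmult_le_pos; [lra|]. left. now apply Rinv_0_lt_compat. }
    replace (2 * M / d ^ 2 * d ^ 2) with (2 * M) in H by (field; lra).
    lra.
Qed.

Lemma SMK_cvg (f : R -> R) (x : R) :
  Rlocb f -> 0 <= x -> continuous_at_halfline f x ->
  is_lim_seq (fun n => SMK n f x) (f x).
Proof.
intros Hf Hx Hc.
assert (Hinv : is_lim_seq (fun n => / INR n) 0).
{ exact (is_lim_seq_inv _ _ is_lim_seq_INR ltac:(discriminate)). }
apply is_lim_seq_spec. intros eps.
assert (He : 0 < eps / 3) by (pose proof (cond_pos eps); lra).
destruct (quadratic_modulus f x (eps / 3) Hx Hf Hc He) as [K [HK Hmod]].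
pose u n := (1 + / INR n) * (eps / 3 + 2 * K * (x * / INR n + / INR n * / INR n))
  + / INR n * Rabs (f x).
assert (Hu : is_lim_seq u (eps / 3)).
{ replace (eps / 3) with
    ((1 + 0) * (eps / 3 + 2 * K * (x * 0 + 0 * 0)) + 0 * Rabs (f x)) by ring.
  repeat (apply is_lim_seq_plus' || apply is_lim_seq_mult' ||
    apply is_lim_seq_const || assumption). }
apply is_lim_seq_spec in Hu.
destruct (Hu (mkposreal _ He)) as [N HN].
exists (Nat.max N 1). intros n Hn.
assert (Hn1 : (1 <= n)%coq_nat) by lia.
specialize (HN n ltac:(lia)). simpl in HN. apply Rabs_def2 in HN.
pose proof (SMK_error f n x (eps / 3) K Hn1 Hx Hf HK Hmod) as Herr.
assert (Hn0 : 0 < / INR n) by (apply Rinv_0_lt_compat, lt_0_INR; lia).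
replace (SMK n f x - f x) with
  ((SMK n f x - (1 + / INR n) * f x) + / INR n * f x) by ring.
apply Rle_lt_trans with (1 := Rabs_triang _ _).
rewrite Rabs_mult (Rabs_pos_eq (/ INR n)); [|lra].
unfold u in HN. lra.
Qed.

(** * Riemann integrable functions are almost everywhere continuous *)

(** The outer measure spares all measurability conditions: it is monotone and
    subadditive on arbitrary sets, and the null sets for it are the Lebesgue
    negligible ones. *)
Local Notation outer A := ((wlength idfun)^*%mu (A : set R)).

Lemma outer_lebesgue (A : set R) : outer A = lebesgue_measure A.
Proof. by []. Qed.

Lemma outerU2 (A B : set R) (u v : R) :
  (outer A <= u%:E)%E -> (outer B <= v%:E)%E ->
  (outer (A `|` B)%classic <= (Rplus u v)%:E)%E.
Proof.
move=> Au Bv; apply: (le_trans (outer_measureU2 _ _ _)).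
rewrite RplusE EFinD; exact: leeD.
Qed.

Definition segment (x y : R) : set R := [set z | x <= z <= y]%classic.

Lemma outer_segment (x y : R) : x <= y ->
  (outer (segment x y) <= (Rminus y x)%:E)%E.
Proof.
move=> /RleP xy.
have -> : segment x y = `[x, y]%classic.
  apply/seteqP; split => z; rewrite /segment /= in_itv /=.
    by case=> /RleP -> /RleP ->.
  by case/andP => /RleP ? /RleP ?.
rewrite outer_lebesgue lebesgue_measure_itv /=; case: ifP => // _.
by rewrite lee_fin RminusE subr_ge0.
Qed.

Lemma outer_In (l : list R) : outer [set z | List.In z l]%classic = 0%E.
Proof.
rewrite outer_lebesgue; apply: countable_lebesgue_measure0.
apply/finite_set_countable/(@sub_finite_set _ _ [set` l]%classic); last exact: finite_seq.
move=> z /=; elim: l => //= a l IH [->|/IH]; rewrite inE; first by rewrite eqxx.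
by move=> ->; rewrite orbT.
Qed.

(** For a step function with nodes [l] and values [lf], in the format consumed
    by [Int_SF]: the union of the closed cells on which its value is at least
    [c]. *)
Fixpoint heavy_cells (c : R) (lf l : list R) : set R :=
  match lf, l with
  | v :: lf', x :: (y :: _) as l' =>
      ((if Rle_dec c v then segment x y else set0)
       `|` heavy_cells c lf' l')%classic
  | _, _ => set0
  end.

(** Markov's inequality for step functions: a cell of length [h] and value [v]
    contributes [v * h / c] to the right-hand side, which is at least [h] when
    [c <= v] and nonnegative otherwise. Subdivisions may have degenerate cells,
    whose values are arbitrary, so nonnegativity is only asked on the others. *)
Lemma outer_heavy_cells (c : R) (lf l : list R) : 0 < c ->
  (forall i, (S i < length l)%coq_nat ->
     RList.pos_Rl l i <= RList.pos_Rl l (S i)) ->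
  (forall i, (S i < length l)%coq_nat ->
     RList.pos_Rl l i < RList.pos_Rl l (S i) -> 0 <= RList.pos_Rl lf i) ->
  (outer (heavy_cells c lf l) <= (Rdiv (Int_SF lf l) c)%:E)%E.
Proof.
intros Hc. revert l.
induction lf as [|v lf IH]; intros l Hord Hpos.
{ simpl. rewrite outer_measure0 lee_fin. apply/RleP.
  change (0 <= 0 / c). lra. }
destruct l as [|x [|y l]].
1, 2: simpl; rewrite outer_measure0 lee_fin; apply/RleP;
  change (0 <= 0 / c); lra.
change (Int_SF (v :: lf) (x :: y :: l)) with (v * (y - x) + Int_SF lf (y :: l)).
replace ((v * (y - x) + Int_SF lf (y :: l)) / c)
  with (v * (y - x) / c + Int_SF lf (y :: l) / c) by (field; lra).
assert (Hxy : x <= y) by (apply (Hord 0%nat); simpl; lia).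
assert (Hv : 0 <= v * (y - x) / c).
{ apply Rmult_le_pos; [|left; now apply Rinv_0_lt_compat].
  destruct Hxy as [Hlt| ->]; [|lra].
  apply Rmult_le_pos; [|lra].
  apply (Hpos 0%nat); [simpl; lia|exact Hlt]. }
apply outerU2; last first.
{ apply IH.
  - intros i Hi. apply (Hord (S i)). simpl in *. lia.
  - intros i Hi. apply (Hpos (S i)). simpl in *. lia. }
destruct (Rle_dec c v) as [Hcv|Hcv].
- apply: le_trans (outer_segment x y Hxy) _.
  rewrite lee_fin. apply/RleP.
  apply (Rmult_le_reg_r c); [exact Hc|].
  replace (v * (y - x) / c * c) with (v * (y - x)) by (field; lra).
  change ((y - x) * c <= v * (y - x)). nra.
- rewrite outer_measure0 lee_fin. apply/RleP. exact Hv.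
Qed.

Lemma heavy_cells_mem (c : R) (lf l : list R) (i : nat) (z : R) :
  length l = S (length lf) -> (i < length lf)%coq_nat ->
  c <= RList.pos_Rl lf i ->
  RList.pos_Rl l i <= z <= RList.pos_Rl l (S i) -> heavy_cells c lf l z.
Proof.
revert l i.
induction lf as [|v lf IH]; intros l i Hlen Hi Hc Hz; [simpl in Hi; lia|].
destruct l as [|x [|y l]]; try discriminate.
destruct i as [|i].
- left. simpl in *. now destruct (Rle_dec c v).
- right. apply (IH (y :: l) i); auto; simpl in *; lia.
Qed.

(** The list need not be sorted: the first node beyond [z] closes a cell that
    contains [z]. *)
Lemma open_cell_or_node (l : list R) (z : R) :
  RList.pos_Rl l 0 <= z -> z <= RList.pos_Rl l (Nat.pred (length l)) ->
  (0 < length l)%coq_nat -> ~ List.In z l ->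
  exists i, (S i < length l)%coq_nat /\
    RList.pos_Rl l i < z < RList.pos_Rl l (S i).
Proof.
induction l as [|x [|y l] IH]; intros Hl Hu Hlen Hnin; [simpl in Hlen; lia| |].
- exfalso. apply Hnin. left. simpl in *. lra.
- destruct (Rlt_le_dec z y) as [Hzy|Hzy].
  + exists 0%nat. split; [simpl; lia|]. simpl in *.
    split; [|exact Hzy].
    destruct Hl as [Hl|Hl]; [exact Hl|]. exfalso. apply Hnin. now left.
  + destruct IH as [i [Hi Hzi]].
    * exact Hzy.
    * exact Hu.
    * simpl; lia.
    * intros Hin. apply Hnin. now right.
    * exists (S i). split; [simpl in *; lia|exact Hzi].
Qed.

Definition jumps (f : R -> R) (b e : R) : set R :=
  [set x | 0 <= x <= b /\ ~ stays_within f e x]%classic.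

(** With [psi] of integral below [e / 2 * eps], Markov's inequality at level
    [e / 2] bounds the outer measure by [eps]. The subdivisions of [phi] and
    [psi] are unrelated: instead of a common refinement, the proof discards the
    nodes of both and works in the intersection of an open cell of each. *)
Lemma outer_jumps (f : R -> R) (b e eps : R) :
  0 < b -> 0 < e -> 0 < eps -> ex_RInt f 0 b ->
  (outer (jumps f b e) <= eps%:E)%E.
Proof.
intros Hb He Heps Hf.
assert (Hd : 0 < e / 2 * eps) by (apply Rmult_lt_0_compat; lra).
destruct (ex_RInt_Reals_0 _ _ _ Hf (mkposreal _ Hd)) as [phi [psi [Hle Hint]]].
rewrite Rmin_left in Hle; [|lra]. rewrite Rmax_right in Hle; [|lra].
unfold RiemannInt_SF in Hint. destruct (Rle_dec 0 b) as [_|Hn]; [|lra].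
destruct phi as [phi [l [lf Hl]]]. destruct psi as [psi [m [mf Hm]]].
unfold subdivision_val, subdivision in Hint. simpl in Hle, Hint.
destruct Hl as (_ & Hl0 & Hlb & Hllen & Hlc).
destruct Hm as (Hmord & Hm0 & Hmb & Hmlen & Hmc).
rewrite -> Rmin_left in Hl0 by lra. rewrite -> Rmin_left in Hm0 by lra.
rewrite -> Rmax_right in Hlb by lra. rewrite -> Rmax_right in Hmb by lra.
assert (Hm_in : forall i, (i < length m)%coq_nat -> 0 <= RList.pos_Rl m i <= b).
{ intros i Hi.
  assert (Hin : List.In (RList.pos_Rl m i) m) by (apply RList.pos_Rl_P2; eauto).
  split; [rewrite -Hm0; now apply RList.RList_P5|].
  rewrite -Hmb. now apply RList.RList_P7. }
assert (Hbound : Int_SF mf m / (e / 2) <= eps).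
{ apply Rabs_def2 in Hint. apply (Rmult_le_reg_r (e / 2)); [lra|].
  replace (Int_SF mf m / (e / 2) * (e / 2)) with (Int_SF mf m) by (field; lra).
  lra. }
assert (Hheavy : (outer (heavy_cells (e / 2) mf m) <= eps%:E)%E).
{ apply: le_trans (outer_heavy_cells (e / 2) mf m _ _ _) _.
  - lra.
  - intros i Hi. apply Hmord. lia.
  - intros i Hi Hlt.
    (* On a nondegenerate cell, psi dominates an absolute value at the
       midpoint. *)
    pose (s := (RList.pos_Rl m i + RList.pos_Rl m (S i)) / 2).
    pose proof (Hm_in i ltac:(lia)). pose proof (Hm_in (S i) Hi).
    rewrite -(Hmc i ltac:(lia) s ltac:(unfold open_interval, s; lra)).
    apply Rle_trans with (2 := Hle s ltac:(unfold s; lra)), Rabs_pos.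
  - rewrite lee_fin. apply/RleP. exact Hbound. }
assert (Hnodes : forall k : list R,
  (outer [set z | List.In z k]%classic <= (IZR 0)%:E)%E).
{ intros k. rewrite outer_In. exact: lexx. }
pose proof (outerU2 _ _ _ _ Hheavy (outerU2 _ _ _ _ (Hnodes m) (Hnodes l))) as H.
replace (eps + (0 + 0)) with eps in H by ring.
apply: le_trans _ H; apply: le_outer_measure => x [Hx Hosc].
destruct (Classical_Prop.classic (List.In x m)) as [|Hxm]; [right; now left|].
destruct (Classical_Prop.classic (List.In x l)) as [|Hxl]; [right; now right|].
left.
destruct (open_cell_or_node l x) as [i [Hi Hxi]]; try lra; [lia|exact Hxl|].
destruct (open_cell_or_node m x) as [j [Hj Hxj]]; try lra; [lia|exact Hxm|].
apply (heavy_cells_mem _ mf m j); [exact Hmlen|lia| |lra].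
apply Rnot_lt_le. intros Hlight. apply Hosc.
exists (Rmin (Rmin (x - RList.pos_Rl l i) (RList.pos_Rl l (S i) - x))
  (Rmin (x - RList.pos_Rl m j) (RList.pos_Rl m (S j) - x))).
split; [repeat apply Rmin_glb_lt; lra|].
intros t Ht Htx.
apply Rmin_Rgt in Htx as [Htl Htm].
apply Rmin_Rgt in Htl as [Htl1 Htl2]. apply Rmin_Rgt in Htm as [Htm1 Htm2].
apply Rabs_def2 in Htl1, Htl2, Htm1, Htm2.
pose proof (Hm_in j ltac:(lia)). pose proof (Hm_in (S j) Hj).
pose proof (Hle t ltac:(lra)) as Hft. pose proof (Hle x ltac:(lra)) as Hfx.
rewrite (Hmc j ltac:(lia) t ltac:(unfold open_interval; lra)) in Hft.
rewrite (Hmc j ltac:(lia) x ltac:(unfold open_interval; lra)) in Hfx.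
rewrite (Hlc i ltac:(lia) t ltac:(unfold open_interval; lra)) in Hft.
rewrite (Hlc i ltac:(lia) x ltac:(unfold open_interval; lra)) in Hfx.
apply Rabs_le_between in Hft, Hfx.
apply Rabs_def1; lra.
Qed.

(** The [n]-th set uses the same integer for the length of the interval and
    for the size [1/(n+1)] of the jump, so that a single countable union
    exhausts all discontinuities. *)
Lemma ae_continuous_at_halfline (f : R -> R) : Rlocb f ->
  {ae lebesgue_measure, forall x : R, 0 <= x -> continuous_at_halfline f x}.
Proof.
intros [_ Hint].
change (lebesgue_measure.-negligible
  (~` [set x | 0 <= x -> continuous_at_halfline f x])%classic).
assert (Hnull : lebesgue_measure.-negligible
  (\bigcup_n jumps f (INR n + 1) (/ (INR n + 1)))%classic).
{ apply: negligible_bigcup => n.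
  apply/negligible_outer_measure/eqP.
  rewrite eq_le outer_measure_ge0 andbT.
  apply/lee_addgt0Pr => eps /RltP Heps. rewrite add0e.
  pose proof (pos_INR n).
  apply: outer_jumps; [lra| |exact Heps|apply Hint; lra].
  apply Rinv_0_lt_compat; lra. }
apply: negligibleS Hnull => x Hx.
apply Classical_Prop.imply_to_and in Hx as [Hx Hc].
rewrite continuous_at_halfline_spec in Hc.
apply Classical_Pred_Type.not_all_ex_not in Hc as [e Hc].
apply Classical_Prop.imply_to_and in Hc as [He Hc].
assert (Hie : 0 < / e) by now apply Rinv_0_lt_compat.
pose proof (INR_archimed 1 (x + / e) ltac:(lra)) as [n Hn].
exists n; [exact I|]. split; [lra|].
intros [d [Hd Hosc]]. apply Hc. exists d. split; [exact Hd|].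
intros t Ht Htx. apply Rlt_le_trans with (1 := Hosc t Ht Htx).
rewrite -(Rinv_inv e). apply Rinv_le_contravar; lra.
Qed.

Theorem theorem8 (f : R -> R) (hf : Rlocb f) :
  (forall x : R, 0 <= x -> continuous_at_halfline f x ->
     is_lim_seq (fun n : nat => SMK n f x) (Finite (f x))) /\
  {ae lebesgue_measure, forall x : R, 0 <= x ->
     is_lim_seq (fun n : nat => SMK n f x) (Finite (f x))}.
Proof.
split.
- intros x Hx. exact (SMK_cvg f x hf Hx).
- apply: negligibleS (ae_continuous_at_halfline f hf) => x Hx Hc.
  apply: Hx => Hx0. exact (SMK_cvg f x hf Hx0 (Hc Hx0)).
Qed.
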